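(* Let $(R,\mathbb{E})$ be a pre-$\lambda$ probability space, with expectation $\mathbb{E}:R\to C$. Then for every $X\in R$, the following identity holds in $\Lambda_C^\wedge$: \[ \mathbb{E}[\mathrm{Exp}_\sigma(-X h_1)]=\tilde{\omega}\bigl(\mathbb{E}[\mathrm{Exp}_\sigma (X h_1)]\bigr). \]
   Context: Rings are commutative with $1$. A pre-$\lambda$ ring is a ring $R$ with a group homomorphism $\sigma_t:(R,+)\to (1+tR[[t]],\times)$, $\sigma_t(r)=\sum_{k\ge 0}(h_k\circ r)t^k$, with $h_0\circ r=1$ and $h_1\circ r=r$. Symmetric functions: $\Lambda$ is the ring of symmetric functions over $\mathbb{Z}$ in variables $t_1,t_2,\ldots$, with elementary symmetric functions $e_i$, complete symmetric functions $h_i$ (so $h_1=t_1+t_2+\cdots$) and monomial symmetric functions $m_\tau$ ($\tau$ a partition). For a ring $A$, $\Lambda_A=\Lambda\otimes_{\mathbb{Z}}A$, and $\Lambda_A^\wedge$ is its completion with respect to degree, i.e. the ring of symmetric power series $\sum_\tau a_\tau m_\tau$ ($a_\tau\in A$, possibly infinite sums over all partitions $\tau$). $\mathrm{Fil}^1\Lambda_A^\wedge$ denotes the symmetric power series with zero constant term. Pre-$\lambda$ structure on $\Lambda_R^\wedge$: for $R$ a pre-$\lambda$ ring, $\Lambda_R^\wedge$ is a pre-$\lambda$ ring by $\sigma_t\bigl(\sum_I r_I \underline{t}^I\bigr)=\prod_I \sigma_{t\underline{t}^I}(r_I)$, where $\underline{t}^I$ ranges over monomials in $t_1,t_2,\ldots$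 and $\sigma_{t\underline{t}^I}(r)=\sum_k (h_k\circ r)(\underline{t}^{I})^k t^k$. For $f\in \mathrm{Fil}^1\Lambda_R^\wedge$, the $\sigma$-exponential is $\mathrm{Exp}_\sigma(f)=\sum_{k\ge 0} h_k\circ f\in\Lambda_R^\wedge$. In particular $\mathrm{Exp}_\sigma(Xh_1)=\prod_i \sigma_{t_i}(X)$ for $X \in R$. A pre-$\lambda$ probability space is a pre-$\lambda$ ring $R$ together with a ring $C$ and an additive map $\mathbb{E}:R\to C$ with $\mathbb{E}[1]=1$. The map $\mathbb{E}$ is applied coefficient-wise to elements of $\Lambda_R^\wedge$: $\mathbb{E}[\sum_\tau r_\tau m_\tau]=\sum_\tau \mathbb{E}[r_\tau]m_\tau\in\Lambda_C^\wedge$. The involution $\tilde\omega$: for a ring $A$, $\omega$ is the standard $A$-algebra involution of $\Lambda_A$ swapping $e_i$ and $h_i$ for all $i$; $\tilde\omega$ is the composition of $\omega$ with the degree flip involution, which acts as $(-1)^i$ on the homogeneous component of degree $i$. It extends continuously to $\Lambda_A^\wedge$. *)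

(* Defs.v *)
Set Warnings "-notation-overridden,-ambiguous-paths,-notation-incompatible-prefix,-redundant-canonical-projection".
From HB Require Import structures.
From mathcomp Require Import all_boot all_algebra finmap.
From mathcomp Require Import boolp classical_sets functions cardinality fsbigop.
From mathcomp Require Import monalg.

Set Implicit Arguments.
Unset Strict Implicit.
Unset Printing Implicit Defensive.

Import GRing.Theory.

Local Open Scope fset_scope.
Local Open Scope classical_set_scope.
Local Open Scope ring_scope.

(* [hop k r] is h_k o r, so sigma_t(r) = sum_k (hop k r) t^k.  Coefficientwise,
   [hopD] says sigma_t(r + s) = sigma_t(r) sigma_t(s). *)
HB.mixin Record isPreLambda R of GRing.ComPzRing R := {
  hop : nat -> R -> R;
  hop0 : forall r, hop 0 r = 1;
  hop1 : forall r, hop 1 r = r;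
  hopD : forall n r s, hop n (r + s) = \sum_(i < n.+1) hop i r * hop (n - i)%N s
}.

#[short(type="preLambdaRingType")]
HB.structure Definition PreLambda := {R of isPreLambda R & GRing.ComPzRing R}.

(* Monomials in the variables t_0, t_1, ... : finitely supported exponents. *)
Notation mon := {cmonom nat}.

Section Monomials.
Variable I : choiceType.
Implicit Types m : {cmonom I}.

Lemma mmulE m1 m2 i : (mmul m1 m2 : {cmonom I}) i = (m1 i + m2 i)%N.
Proof. exact: cmM. Qed.

Definition mrename (s s' : I -> I) m : {cmonom I} :=
  mkcmonom [fsfun j in [fset s i | i in finsupp m] => m (s' j) | 0%N].

Lemma mrenameE s s' m j : cancel s' s -> mrename s s' m j = m (s' j).
Proof.
move=> s'K; rewrite cmE fsfun_fun; case: imfsetP => // h.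
apply/esym/fsfun_dflt/negP => s'j; apply: h.
by exists (s' j).
Qed.

Lemma cmonomP m1 m2 : (forall i, m1 i = m2 i) -> m1 = m2.
Proof. by move=> h; apply/eqP/cmP. Qed.

Lemma mrenameK s s' m : cancel s s' -> cancel s' s ->
  mrename s' s (mrename s s' m) = m.
Proof. by move=> sK s'K; apply: cmonomP => i; rewrite !mrenameE ?sK. Qed.

Lemma mrenameM s s' m1 m2 : cancel s' s ->
  mrename s s' (mmul m1 m2) = mmul (mrename s s' m1) (mrename s s' m2).
Proof.
by move=> s'K; apply: cmonomP => i; rewrite mmulE !mrenameE // mmulE.
Qed.

Lemma mrename_supp s s' m : cancel s s' -> cancel s' s ->
  perm_eq (finsupp (mrename s s' m)) [seq s i | i <- finsupp m].
Proof.
move=> sK s'K; apply: uniq_perm; first exact: fset_uniq.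
  by rewrite map_inj_uniq ?fset_uniq //; exact: can_inj sK.
move=> j; rewrite -cmE_neq0 mrenameE // cmE_neq0.
by rewrite -{2}[j]s'K (mem_map (can_inj sK)).
Qed.

Lemma mdeg_mrename s s' m : cancel s s' -> cancel s' s ->
  mdeg (mrename s s' m) = mdeg m.
Proof.
move=> sK s'K; rewrite /mdeg (perm_big _ (mrename_supp m sK s'K)) big_map.
by apply: eq_bigr => i _; rewrite mrenameE // sK.
Qed.
Lemma finite_divisors m : finite_set [set d : {cmonom I} | forall i, (d i <= m i)%N].
Proof.
pose N := (mdeg m).+1.
pose F (k : {ffun finsupp m -> 'I_N}) : {cmonom I} :=
  mkcmonom [fsfun i : finsupp m => (k i : nat) | 0%N].
apply: (sub_finite_set (B := F @` setT)); last exact/finite_image/finite_finset.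
move=> d /= dm.
have mN i : (m i < N)%N.
  rewrite ltnS; case: (boolP (i \in finsupp m)) => [im|]; last first.
    by rewrite -cmE_neq0 negbK => /eqP ->.
  by rewrite /mdeg (big_fsetD1 i) //= leq_addr.
exists [ffun i => Ordinal (leq_ltn_trans (dm (fsval i)) (mN _))] => //.
apply: cmonomP => i; rewrite cmE fsfun_ffun.
case: insubP => [u _ <-|im] /=; first by rewrite ffunE.
by have := dm i; move: im; rewrite -cmE_neq0 negbK => /eqP ->; rewrite leqn0 => /eqP.
Qed.

Definition dvs m : {fset {cmonom I}} :=
  locked (fset_set [set d : {cmonom I} | forall i, (d i <= m i)%N]).

Lemma mem_dvs m d : (d \in dvs m) = `[< forall i, (d i <= m i)%N >].
Proof. by rewrite /dvs -lock in_fset_set ?inE //; exact: finite_divisors. Qed.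

Lemma dvs_mull m1 m2 : m1 \in dvs (mmul m1 m2).
Proof. by rewrite mem_dvs; apply/asboolP => i; rewrite mmulE leq_addr. Qed.
Lemma dvs_mulr m1 m2 : m2 \in dvs (mmul m1 m2).
Proof. by rewrite mem_dvs; apply/asboolP => i; rewrite mmulE leq_addl. Qed.
Lemma dvs_trans m1 m2 m3 : m1 \in dvs m2 -> m2 \in dvs m3 -> m1 \in dvs m3.
Proof.
rewrite !mem_dvs => /asboolP h1 /asboolP h2; apply/asboolP => i.
exact: leq_trans (h1 i) (h2 i).
Qed.

Definition conv (A : comPzRingType) (f g : {cmonom I} -> A) m : A :=
  \sum_(p \in [set p : {cmonom I} * {cmonom I} | mmul p.1 p.2 = m]) f p.1 * g p.2.

Lemma convE (A : comPzRingType) (D : {fset {cmonom I}}) (f g : {cmonom I} -> A) m : {subset dvs m <= D} ->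
  conv f g m = \sum_(a <- D) \sum_(b <- D) if mmul a b == m then f a * g b else 0.
Proof.
move=> mD; pose r := [seq p <- [seq (a, b) | a <- D, b <- D] | mmul p.1 p.2 == m].
have ru : uniq r by apply/filter_uniq/allpairs_uniq => // -[? ?] [].
rewrite /conv (fsbigE r) //=; last 2 first.
- by move=> p /=; rewrite mem_filter => /andP[/eqP].
- move=> [a b] /= ab; rewrite mem_filter /= ab eqxx /= => /negP[].
  by apply/allpairsP; exists (a, b); split=> //=; apply: mD; rewrite -ab;
    [exact: dvs_mull|exact: dvs_mulr].
rewrite /r big_filter_cond big_mkcond big_allpairs /=.
apply: eq_bigr => a _; apply: eq_bigr => b _.
case: eqP => //= e; rewrite ifT //; exact/mem_set.
Qed.


Lemma expcmnE m n i : expcmn m n i = (n * m i)%N.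
Proof.
rewrite /expcmn; case: n => [|n]; first by rewrite mul0n; exact: cm1.
elim: n => [|n IH]; first by rewrite mul1n.
by rewrite iteropS in IH; rewrite iteropS iterS mulcmE IH -mulSn.
Qed.
End Monomials.

(* [K] is a multiset of monomials, and [meval K] is the product of its elements,
   i.e. the product of the I^(K I). *)
Definition meval (K : {cmonom mon}) : mon :=
  \big[mmul/mone]_(I <- finsupp K) expcmn I (K I).

Lemma mevalE (D : {fset mon}) (K : {cmonom mon}) i : (finsupp K `<=` D)%fset ->
  meval K i = (\sum_(I <- D) K I * I i)%N.
Proof.
move=> KD; rewrite -(big_fset_incl _ KD) => [|I _]; last first.
  by rewrite -cmE_neq0 negbK => /eqP ->; rewrite mul0n.
rewrite /meval; elim/big_rec2: _ => [|I x y _ <-]; first exact: cm1.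
by rewrite mmulE expcmnE.
Qed.

Lemma mevalM (K L : {cmonom mon}) : meval (mmul K L) = mmul (meval K) (meval L).
Proof.
apply: cmonomP => i; pose D := finsupp (mmul K L : {cmonom mon}).
have KL : D = (finsupp K `|` finsupp L)%fset by rewrite /D -mdomD.
rewrite mmulE (@mevalE D) // (@mevalE D K) ?KL ?fsubsetUl // (@mevalE D L) ?KL ?fsubsetUr //.
rewrite -big_split /=.
by apply: eq_bigr => I _; rewrite mmulE mulnDl.
Qed.

Lemma meval_rename s s' (K : {cmonom mon}) : cancel s s' -> cancel s' s ->
  meval (mrename (mrename s s') (mrename s' s) K) = mrename s s' (meval K).
Proof.
move=> sK s'K; apply: cmonomP => i; rewrite mrenameE //.
have rK m := mrenameK m sK s'K; have r'K m := mrenameK m s'K sK.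
rewrite (@mevalE (finsupp K) K) // (mevalE _ (fsubset_refl _)).
rewrite (perm_big _ (mrename_supp K rK r'K)) big_map.
by apply: eq_bigr => I _; rewrite !mrenameE // rK.
Qed.

Lemma finite_meval n m :
  finite_set [set K : {cmonom mon} | (mdeg K <= n)%N /\ meval K \in dvs m].
Proof.
pose B : {cmonom mon} := mkcmonom [fsfun I in dvs m => n | 0%N].
apply: sub_finite_set (finite_divisors B) => K /= [Kn Km] I.
rewrite cmE fsfun_fun; case: (boolP (I \in finsupp K)) => [IK|]; last first.
  by rewrite -cmE_neq0 negbK => /eqP ->.
have KI_gt0 : (0 < K I)%N by rewrite lt0n cmE_neq0.
have KIn : (K I <= n)%N.
  by apply: leq_trans Kn; rewrite /mdeg (big_fsetD1 I) //= leq_addr.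
rewrite ifT //; apply: dvs_trans Km; rewrite mem_dvs; apply/asboolP => i.
rewrite (mevalE _ (fsubset_refl _)) (big_fsetD1 I) //=.
by apply: leq_trans (leq_addr _ _); rewrite leq_pmull.
Qed.

(* The completion of Lambda_A: power series over A in countably many variables
   that are invariant under every permutation of the variables.  Such a series
   is sum_tau a_tau m_tau, where a_tau is the common coefficient of the monomials
   whose exponents form the partition tau. *)
Record sps (A : comPzRingType) := Sps {
  coef :> mon -> A;
  coef_sym : forall s : nat -> nat, bijective s ->
    forall m m' : mon, (forall i, m' (s i) = m i) -> coef m' = coef m
}.

Section Sps.
Variable A : comPzRingType.
Implicit Types f g h : sps A.

HB.instance Definition _ := gen_eqMixin (sps A).
HB.instance Definition _ := gen_choiceMixin (sps A).

Lemma spsP f g : (forall m, f m = g m) -> f = g.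
Proof.
case: f g => [f fs] [g gs] /= /funext fg; rewrite fg in fs *.
by congr Sps; exact: Prop_irrelevance.
Qed.

Lemma sps_rename f s s' m : cancel s s' -> cancel s' s ->
  f (mrename s s' m) = f m.
Proof.
move=> sK s'K; apply: (@coef_sym _ f s); first by exists s'.
by move=> i; rewrite mrenameE // sK.
Qed.

Lemma sym_of_rename (f : mon -> A) :
  (forall s s', cancel s s' -> cancel s' s ->
    forall m, f (mrename s s' m) = f m) ->
  forall s : nat -> nat, bijective s ->
    forall m m' : mon, (forall i, m' (s i) = m i) -> f m' = f m.
Proof.
move=> fS s [s' sK s'K] m m' mm'; rewrite -(fS s s' sK s'K m); congr f.
by apply: cmonomP => i; rewrite mrenameE // -mm' s'K.
Qed.

Definition sps0 : sps A := @Sps A (fun=> 0) (fun _ _ _ _ _ => erefl).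
Lemma spsD_sym f g : forall s : nat -> nat, bijective s ->
  forall m m' : mon, (forall i, m' (s i) = m i) -> f m' + g m' = f m + g m.
Proof. by move=> s sb m m' e; rewrite !(coef_sym _ sb e). Qed.
Definition spsD f g : sps A := Sps (spsD_sym f g).
Lemma spsZ_sym (a : A) f : forall s : nat -> nat, bijective s ->
  forall m m' : mon, (forall i, m' (s i) = m i) -> a * f m' = a * f m.
Proof. by move=> s sb m m' e; rewrite (coef_sym _ sb e). Qed.
Definition spsZ a f : sps A := Sps (spsZ_sym a f).

Lemma spsDA : associative spsD.
Proof. by move=> f g h; apply: spsP => m; exact: addrA. Qed.
Lemma spsDC : commutative spsD.
Proof. by move=> f g; apply: spsP => m; exact: addrC. Qed.
Lemma sps0D : left_id sps0 spsD.
Proof. by move=> f; apply: spsP => m; exact: add0r. Qed.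
Lemma spsND : left_inverse sps0 (spsZ (-1)) spsD.
Proof. by move=> f; apply: spsP => m; rewrite /= mulN1r addNr. Qed.

HB.instance Definition _ := GRing.isZmodule.Build (sps A) spsDA spsDC sps0D spsND.

Lemma spsZA a b f : spsZ a (spsZ b f) = spsZ (a * b) f.
Proof. by apply: spsP => m; exact: mulrA. Qed.
Lemma sps1Z : left_id 1 spsZ.
Proof. by move=> f; apply: spsP => m; exact: mul1r. Qed.
Lemma spsZDr : right_distributive spsZ +%R.
Proof. by move=> a f g; apply: spsP => m; exact: mulrDr. Qed.
Lemma spsZDl f : {morph spsZ^~ f : a b / a + b}.
Proof. by move=> a b; apply: spsP => m; exact: mulrDl. Qed.

HB.instance Definition _ :=
  GRing.Zmodule_isLmodule.Build A (sps A) spsZA sps1Z spsZDr spsZDl.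

Lemma conv_sym f g : forall s : nat -> nat, bijective s ->
  forall m m' : mon, (forall i, m' (s i) = m i) -> conv f g m' = conv f g m.
Proof.
apply: sym_of_rename => s s' sK s'K m.
rewrite /conv (reindex_fsbig (fun p : mon * mon =>
  (mrename s s' p.1, mrename s s' p.2)) [set p | mmul p.1 p.2 = m]).
  by apply: eq_fsbigr => p _; rewrite !sps_rename.
split.
- by move=> p /= <-; rewrite mrenameM.
- move=> [a b] [c d] _ _ /= [/(congr1 (mrename s' s)) + /(congr1 (mrename s' s))].
  by rewrite !mrenameK // => -> ->.
- move=> [a b] /= ab; exists (mrename s' s a, mrename s' s b) => /=.
    by rewrite -mrenameM // ab mrenameK.
  by rewrite !mrenameK.
Qed.
Definition spsM f g : sps A := Sps (@conv_sym f g).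

Lemma sps1_sym : forall s : nat -> nat, bijective s ->
  forall m m' : mon, (forall i, m' (s i) = m i) ->
  (m' == mone)%:R = (m == mone)%:R :> A.
Proof.
apply: sym_of_rename => s s' sK s'K m.
by rewrite -!mdeg_eq0 mdeg_mrename.
Qed.
Definition sps1 : sps A := Sps sps1_sym.

Lemma spsMC : commutative spsM.
Proof.
move=> f g; apply: spsP => m; rewrite /= !(convE (D := dvs m)) //.
rewrite exchange_big /=; apply: eq_bigr => a _; apply: eq_bigr => b _.
by rewrite mulmC mulrC.
Qed.

Lemma spsMA : associative spsM.
Proof.
move=> f g h; apply: spsP => m /=; pose D := dvs m.
have DD d : d \in D -> {subset dvs d <= D} by move=> dD c cd; exact: dvs_trans cd dD.
rewrite !(convE (D := D)) //=.
transitivity (\sum_(a <- D) \sum_(b <- D) \sum_(c <- D)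
    if mmul a (mmul b c) == m then f a * (g b * h c) else 0).
  apply: eq_bigr => a _.
  transitivity (\sum_(d <- D) \sum_(b <- D) \sum_(c <- D)
      if (mmul b c == d) && (mmul a d == m) then f a * (g b * h c) else 0).
    rewrite [LHS]big_seq [RHS]big_seq; apply: eq_bigr => d dD.
    case: eqP => [e|ne]; last first.
      by rewrite big1 // => b _; rewrite big1 // => c _; rewrite andbF.
    rewrite (convE (D := D)) ?mulr_sumr; last exact: DD.
    apply: eq_bigr => b _; rewrite mulr_sumr; apply: eq_bigr => c _.
    by rewrite andbT; case: ifP => //; rewrite mulr0.
  rewrite exchange_big /=; apply: eq_bigr => b _.
  rewrite exchange_big /=; apply: eq_bigr => c _.
  case: eqP => [e|ne]; last first.
    by rewrite big1 // => d _; case: andP => // -[/eqP <- /eqP].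
  have bcD : mmul b c \in D by rewrite /D -e; exact: dvs_mulr.
  rewrite (big_fsetD1 _ bcD) /= eqxx e eqxx /= big1_seq ?addr0 // => d /=.
  by rewrite in_fsetD1 eq_sym => /andP[/negPf -> _].
transitivity (\sum_(c <- D) \sum_(a <- D) \sum_(b <- D)
    if mmul (mmul a b) c == m then f a * g b * h c else 0).
  rewrite [RHS]exchange_big /=; apply: eq_bigr => a _.
  rewrite [RHS]exchange_big /=; apply: eq_bigr => b _.
  by apply: eq_bigr => c _; rewrite mulmA mulrA.
rewrite [RHS]exchange_big /=; apply: eq_bigr => c _.
transitivity (\sum_(d <- D) \sum_(a <- D) \sum_(b <- D)
    if (mmul a b == d) && (mmul d c == m) then f a * g b * h c else 0); last first.
  rewrite [LHS]big_seq [RHS]big_seq; apply: eq_bigr => d dD.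
  case: eqP => [e|ne]; last first.
    by rewrite big1 // => b _; rewrite big1 // => a _; rewrite andbF.
  rewrite (convE (D := D)) ?mulr_suml; last exact: DD.
  apply: eq_bigr => b _; rewrite mulr_suml; apply: eq_bigr => a _.
  by rewrite andbT; case: ifP => //; rewrite mul0r.
rewrite [RHS]exchange_big /=; apply: eq_bigr => a _.
rewrite [RHS]exchange_big /=; apply: eq_bigr => b _.
case: eqP => [e|ne]; last first.
  by rewrite big1 // => d _; case: andP => // -[/eqP <- /eqP].
have bcD : mmul a b \in D by rewrite /D -e; exact: dvs_mull.
rewrite (big_fsetD1 _ bcD) /= eqxx e eqxx /= big1_seq ?addr0 // => d /=.
by rewrite in_fsetD1 eq_sym => /andP[/negPf -> _].
Qed.

Lemma sps1M : left_id sps1 spsM.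
Proof.
move=> f; apply: spsP => m; rewrite /= (convE (D := dvs m)) //.
have mm : m \in dvs m by rewrite mem_dvs; apply/asboolP.
have m1 : mone \in dvs m by rewrite mem_dvs; apply/asboolP => i; rewrite cm1.
rewrite (bigD1_seq _ m1) ?fset_uniq //= (bigD1_seq _ mm) ?fset_uniq //=.
rewrite mul1m !eqxx mul1r.
rewrite [X in _ + X]big1 ?addr0 => [|d /negPf d1]; last first.
  by rewrite big1 // => b _; rewrite d1 mul0r if_same.
by rewrite big1 ?addr0 // => d /negPf d1; rewrite mul1m d1.
Qed.

Lemma spsMDl : left_distributive spsM +%R.
Proof.
move=> f g h; apply: spsP => m; rewrite /= !(convE (D := dvs m)) // -big_split /=.
apply: eq_bigr => a _; rewrite -big_split; apply: eq_bigr => b _ /=.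
by case: ifP; rewrite ?addr0 // mulrDl.
Qed.

HB.instance Definition _ :=
  GRing.Zmodule_isComPzRing.Build (sps A) spsMA spsMC sps1M spsMDl.

Lemma elsym_sym n : forall s : nat -> nat, bijective s ->
  forall m m' : mon, (forall i, m' (s i) = m i) ->
  (`[< mdeg m' = n /\ forall i, (m' i <= 1)%N >])%:R =
  (`[< mdeg m = n /\ forall i, (m i <= 1)%N >])%:R :> A.
Proof.
apply: sym_of_rename => s s' sK s'K m; congr ((nat_of_bool _)%:R).
apply/asbool_equiv_eq; rewrite mdeg_mrename //; split=> -[-> mi]; split=> // i.
  by have := mi (s i); rewrite mrenameE // sK.
by rewrite mrenameE.
Qed.
Definition elsym n : sps A := Sps (@elsym_sym n).

Lemma hsym_sym n : forall s : nat -> nat, bijective s ->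
  forall m m' : mon, (forall i, m' (s i) = m i) ->
  (mdeg m' == n)%:R = (mdeg m == n)%:R :> A.
Proof. by apply: sym_of_rename => s s' sK s'K m; rewrite mdeg_mrename. Qed.
Definition hsym n : sps A := Sps (@hsym_sym n).

(* Fil^n: the symmetric power series with no term of degree less than n. *)
Definition Fil n : set (sps A) := [set f | forall m, (mdeg m < n)%N -> f m = 0].

Lemma flip_sym f : forall s : nat -> nat, bijective s ->
  forall m m' : mon, (forall i, m' (s i) = m i) ->
  (-1) ^+ mdeg m' * f m' = (-1) ^+ mdeg m * f m.
Proof.
by apply: sym_of_rename => s s' sK s'K m; rewrite sps_rename // mdeg_mrename.
Qed.
(* Multiplication by (-1)^d on the component of degree d. *)
Definition flip f : sps A := Sps (@flip_sym f).

(* The continuous extension of the standard involution of Lambda_A, which is the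
   dense subalgebra of the elements of bounded degree.  Continuity is with
   respect to the degree filtration; it is enough to state it at 0 since w is
   linear.  These properties determine w, as Lambda_A = A[e_1, e_2, ...]. *)
Record is_omega (w : sps A -> sps A) : Prop := {
  omega_linear : linear w;
  omega_mul : monoid_morphism w;
  omega_invol : involutive w;
  omega_e : forall i, w (elsym i) = hsym i;
  omega_h : forall i, w (hsym i) = elsym i;
  omega_cont : forall n, exists p, forall f, Fil p f -> Fil n (w f)
}.

(* The unique map satisfying [is_omega]; [id] is only the default of [xget]. *)
Definition omega : sps A -> sps A := @xget (sps A -> sps A) id [set w | is_omega w].

Definition omega_tilde f : sps A := omega (flip f).
End Sps.

Section Map.
Variables (A B : comPzRingType) (E : A -> B).
Lemma sps_map_sym (f : sps A) : forall s : nat -> nat, bijective s ->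
  forall m m' : mon, (forall i, m' (s i) = m i) -> E (f m') = E (f m).
Proof. by move=> s sb m m' e; rewrite (coef_sym _ sb e). Qed.
Definition sps_map f : sps B := Sps (@sps_map_sym f).
End Map.

Section PreLambdaSps.
Variable R : preLambdaRingType.
Implicit Types (f g : sps R) (K : {cmonom mon}).

Definition hop_term (f : mon -> R) K : R :=
  \prod_(I <- finsupp K) hop (K I) (f I).

(* The coefficient of t^k m in prod_I sigma_{t I}(f_I), I ranging over all the
   monomials: expanding the product amounts to choosing the term
   (h_{K I} o f_I) I^(K I) t^(K I) in each factor, with K I = 0 for almost all I
   since every factor has constant term 1.  Only finitely many K contribute
   (see [finite_meval]). *)
Definition hop_coef k (f : mon -> R) (m : mon) : R :=
  \sum_(K \in [set K : {cmonom mon} | mdeg K = k /\ meval K = m]) hop_term f K.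

Lemma hop_termE (D : {fset mon}) (f : mon -> R) K : (finsupp K `<=` D)%fset ->
  hop_term f K = \prod_(I <- D) hop (K I) (f I).
Proof.
move=> KD; rewrite /hop_term (big_fset_incl _ KD) // => I _.
by rewrite -cmE_neq0 negbK => /eqP ->; rewrite hop0.
Qed.

Lemma hop_sym k f : forall s : nat -> nat, bijective s ->
  forall m m' : mon, (forall i, m' (s i) = m i) ->
  hop_coef k f m' = hop_coef k f m.
Proof.
apply: sym_of_rename => s s' sK s'K m.
have rK n := mrenameK n sK s'K; have r'K n := mrenameK n s'K sK.
rewrite /hop_coef (reindex_fsbig (mrename (mrename s s') (mrename s' s))
  [set K : {cmonom mon} | mdeg K = k /\ meval K = m]).
  apply: eq_fsbigr => K _.
  rewrite /hop_term (perm_big _ (mrename_supp K rK r'K)) big_map.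
  by apply: eq_bigr => I _; rewrite mrenameE // rK sps_rename.
split.
- by move=> K /= [<- <-]; rewrite mdeg_mrename // meval_rename.
- by move=> K L _ _ /(congr1 (mrename (mrename s' s) (mrename s s'))); rewrite !mrenameK.
- move=> K /= [Kk Km]; exists (mrename (mrename s' s) (mrename s s') K).
    by rewrite mdeg_mrename // meval_rename // Km rK.
  by rewrite mrenameK.
Qed.
Definition sps_hop k f : sps R := Sps (@hop_sym k f).

Lemma sps_hop0 f : sps_hop 0 f = 1.
Proof.
apply: spsP => m; rewrite /= /hop_coef.
have meval1 : meval mone = mone by rewrite /meval mdom1 big_seq_fset0.
have [->|m1] := eqVneq m mone.
  rewrite (_ : [set K | _] = [set mone]) ?fsbig_set1 ?/hop_term ?mdom1 ?big_seq_fset0 //.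
  by apply/seteqP; split=> [K [/mdeg_eq0I]|K ->] //=; split=> //; exact: mdeg1.
rewrite (_ : [set K | _] = set0) ?fsbig_set0 //; apply/seteqP; split=> // K [].
by move=> /mdeg_eq0I -> mm; move: m1; rewrite -mm meval1 eqxx.
Qed.

Lemma mdeg_eq1 K : mdeg K = 1%N -> exists I, K = ucm I.
Proof.
move=> K1; have [I IK] : exists I, I \in finsupp K.
  case: (fset_0Vmem (finsupp K)) => [K0|[I IK]]; last by exists I.
  by move: K1; rewrite /mdeg K0 big_seq_fset0.
exists I; pose L : {cmonom mon} := divcm K (ucm I).
have KL : K = mmul (ucm I) L.
  apply: cmonomP => J; rewrite mmulE divcmE cmU subnKC //.
  by case: eqP => // <-; rewrite lt0n cmE_neq0.
move: K1; rewrite {1}KL mdegM mdegU -[RHS]addn0 => /addnI /mdeg_eq0I L1.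
by rewrite KL L1 mulm1.
Qed.

Lemma meval_ucm m : meval (ucm m) = m.
Proof.
rewrite /meval mdomU big_seq_fset1 cmUU; apply: cmonomP => i.
by rewrite expcmnE mul1n.
Qed.

Lemma sps_hop1 f : sps_hop 1 f = f.
Proof.
apply: spsP => m; rewrite /= /hop_coef.
rewrite (_ : [set K | _] = [set ucm m]) ?fsbig_set1.
  by rewrite /hop_term mdomU big_seq_fset1 cmUU hop1.
apply/seteqP; split=> [K /= [/mdeg_eq1 [I ->]]|K -> /=].
  by rewrite meval_ucm => ->.
by rewrite meval_ucm mdegU.
Qed.

Lemma prod_sum_dvs K (F : mon -> nat -> R) :
  \prod_(I <- finsupp K) \sum_(i < (K I).+1) F I i =
  \sum_(L <- dvs K) \prod_(I <- finsupp K) F I (L I).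
Proof.
pose N := mdeg K.
have KN I : (K I <= N)%N.
  case: (boolP (I \in finsupp K)) => [IK|]; last first.
    by rewrite -cmE_neq0 negbK => /eqP ->.
  by rewrite /N /mdeg (big_fsetD1 I) //= leq_addr.
pose mk (t : {ffun finsupp K -> 'I_N.+1}) : {cmonom mon} :=
  mkcmonom [fsfun I : finsupp K => (t I : nat) | 0%N].
pose Q (u : finsupp K) := [pred i : 'I_N.+1 | (i < (K (val u)).+1)%N].
have mkE t (u : finsupp K) : mk t (val u) = t u.
  by rewrite cmE fsfun_ffun valK.
have mk_inj : injective mk.
  by move=> t t' e; apply/ffunP => u; apply: val_inj; rewrite /= -!mkE e.
have perm_mk : perm_eq (dvs K) [seq mk t | t <- enum (family Q)].
  apply: uniq_perm => //; first by rewrite map_inj_uniq ?enum_uniq.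
  move=> L; rewrite mem_dvs; apply/asboolP/mapP => [LK|[t + ->] I].
    exists [ffun u => inord (L (val u))].
      rewrite mem_enum; apply/familyP => u; rewrite ffunE !inE ltnS inordK //.
      by rewrite ltnS; apply: leq_trans (KN (val u)).
    apply: cmonomP => I; case: (boolP (I \in finsupp K)) => IK.
      have -> : I = val (Sub I IK : finsupp K) by rewrite SubK.
      by rewrite mkE ffunE inordK // ltnS; apply: leq_trans (KN _).
    rewrite cmE fsfun_ffun insubN //.
    have K0 : K I = 0%N by apply/eqP; rewrite cmE_eq0.
    by have := LK I; rewrite K0 leqn0 => /eqP.
  rewrite mem_enum => /familyP tQ.
  case: (boolP (I \in finsupp K)) => IK; last by rewrite cmE fsfun_ffun insubN.
  have -> : I = val (Sub I IK : finsupp K) by rewrite SubK.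
  by rewrite mkE; have := tQ (Sub I IK); rewrite !inE ltnS.
rewrite (perm_big _ perm_mk) big_map big_enum /= big_seq_fsetE /=.
under eq_bigr => u _ do rewrite (big_ord_widen N.+1 (F (val u))) ?ltnS ?KN //.
rewrite (bigA_distr_big_dep Q (fun u i => F (val u) i)).
by apply: eq_bigr => t _; rewrite big_seq_fsetE /=; apply: eq_bigr => u _; rewrite mkE.
Qed.

Lemma finsupp_dvs K L : L \in dvs K -> (finsupp L `<=` finsupp K)%fset.
Proof.
rewrite mem_dvs => /asboolP LK; apply/fsubsetP => I; rewrite -!cmE_neq0 -!lt0n.
by move=> /leq_trans; apply.
Qed.

Lemma hop_termD f g K : hop_term (f + g) K = conv (hop_term f) (hop_term g) K.
Proof.
pose F I i := hop i (f I) * hop (K I - i)%N (g I).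
rewrite /hop_term (eq_bigr (fun I => \sum_(i < (K I).+1) F I i)) => [|I _]; last first.
  exact: hopD.
rewrite prod_sum_dvs (convE (D := dvs K)) // [LHS]big_seq [RHS]big_seq.
apply: eq_bigr => L LD; have LK I : (L I <= K I)%N by move: LD; rewrite mem_dvs => /asboolP.
have KL : K = mmul L (divcm K L).
  by apply: cmonomP => I; rewrite mmulE divcmE subnKC.
have KLD : divcm K L \in dvs K by rewrite {2}KL; exact: dvs_mulr.
rewrite (bigD1_seq _ KLD) ?fset_uniq //= -KL eqxx [X in _ + X]big1 => [|M ML].
  rewrite addr0 /F big_split /= -/(hop_term f L) -/(hop_term g (divcm K L)).
  rewrite (hop_termE f (finsupp_dvs LD)) (hop_termE g (finsupp_dvs KLD)).
  by congr (_ * _); apply: eq_bigr => I _; rewrite divcmE.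
case: ifP => // /eqP LM; case/eqP: ML; apply: cmonomP => I.
by rewrite divcmE -LM mmulE addKn.
Qed.

Lemma sps_hopD n f g :
  sps_hop n (f + g) = \sum_(i < n.+1) sps_hop i f * sps_hop (n - i)%N g.
Proof.
apply: spsP => m.
pose S := fset_set [set K : {cmonom mon} | (mdeg K <= n)%N /\ meval K \in dvs m].
have memS K : (K \in S) = (mdeg K <= n)%N && (meval K \in dvs m).
  rewrite /S in_fset_set; last exact: finite_meval.
  by apply/idP/andP; rewrite inE.
have hopE (u : mon -> R) k m' : (k <= n)%N -> m' \in dvs m -> hop_coef k u m' =
    \sum_(K <- S) if (mdeg K == k) && (meval K == m') then hop_term u K else 0.
  move=> kn m'm; pose r := [seq K <- S | (mdeg K == k) && (meval K == m')].
  rewrite /hop_coef (fsbigE r) //=; last 3 first.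
  - exact/filter_uniq/fset_uniq.
  - by move=> K /=; rewrite mem_filter => /andP[/andP[/eqP -> /eqP ->]].
  - move=> K [Kk Km']; rewrite mem_filter memS Kk Km' !eqxx kn m'm.
    by move=> /negP[].
  rewrite /r big_filter_cond big_mkcond; apply: eq_bigr => K _.
  by rewrite andb_idr // => /andP[/eqP Kk /eqP Km]; apply/mem_set.
have mm : m \in dvs m by rewrite mem_dvs; apply/asboolP.
transitivity (\sum_(K <- S) \sum_(L <- S)
    if (mdeg (mmul K L : {cmonom mon}) == n) && (meval (mmul K L) == m)
    then hop_term f K * hop_term g L else 0).
  rewrite /= hopE //.
  transitivity (\sum_(M <- S) \sum_(K <- S) \sum_(L <- S)
      if (mmul K L == M) && ((mdeg M == n) && (meval M == m))
      then hop_term f K * hop_term g L else 0).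
    rewrite [LHS]big_seq [RHS]big_seq; apply: eq_bigr => M MS.
    case: ifP => _; last first.
      by rewrite big1 // => K _; rewrite big1 // => L _; rewrite andbF.
    rewrite hop_termD (convE (D := S)) => [|K KM].
      by apply: eq_bigr => K _; apply: eq_bigr => L _; rewrite andbT.
    move: MS KM; rewrite !memS mem_dvs => /andP[Mn Mm] /asboolP KM.
    have MK : M = mmul K (divcm M K).
      by apply: cmonomP => I; rewrite mmulE divcmE subnKC.
    rewrite MK mdegM in Mn; rewrite (leq_trans _ Mn) ?leq_addr //=.
    by apply: dvs_trans Mm; rewrite MK mevalM; exact: dvs_mull.
  rewrite exchange_big; apply: eq_bigr => K _ /=.
  rewrite exchange_big; apply: eq_bigr => L _ /=.
  case: ifP => [KLm|KLm]; last first.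
    by rewrite big1 // => M _; case: ifP => // /andP[/eqP <-]; rewrite KLm.
  have KLS : mmul K L \in S.
    by rewrite memS; case/andP: KLm => /eqP -> /eqP ->; rewrite leqnn.
  rewrite (bigD1_seq _ KLS) ?fset_uniq //= eqxx KLm /= big1 ?addr0 // => M.
  by rewrite eq_sym => /negPf ->.
have coef_sum (u : 'I_n.+1 -> sps R) : (\sum_i u i : sps R) m = \sum_i u i m.
  by elim/big_rec2: _ => // i x y _ <-.
rewrite coef_sum.
pose G (i : 'I_n.+1) (a b : mon) K L :=
  [&& mmul a b == m, mdeg K == i, meval K == a, mdeg L == (n - i)%N & meval L == b].
transitivity (\sum_(i < n.+1) \sum_(a <- dvs m) \sum_(b <- dvs m)
    \sum_(K <- S) \sum_(L <- S)
    if G i a b K L then hop_term f K * hop_term g L else 0); last first.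
  apply: eq_bigr => i _; rewrite /= (convE (D := dvs m)) //.
  rewrite [LHS]big_seq [RHS]big_seq; apply: eq_bigr => a am.
  rewrite [LHS]big_seq [RHS]big_seq; apply: eq_bigr => b bm.
  rewrite /G; case: ifP => _ /=; last first.
    by rewrite big1 // => K _; rewrite big1.
  rewrite !hopE ?leq_subr // -1?ltnS //.
  rewrite mulr_suml; apply: eq_bigr => K _; rewrite mulr_sumr; apply: eq_bigr => L _.
  by case: (mdeg K == i); case: (meval K == a); case: (mdeg L == _);
    case: (meval L == b); rewrite /= ?mulr0 ?mul0r.
rewrite [RHS](eq_bigr (fun i => \sum_(a <- dvs m) \sum_(K <- S) \sum_(L <- S)
    \sum_(b <- dvs m) if G i a b K L then hop_term f K * hop_term g L else 0)); last first.
  move=> i _; apply: eq_bigr => a _; rewrite exchange_big; apply: eq_bigr => K _.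
  by rewrite exchange_big.
rewrite [RHS](eq_bigr (fun i => \sum_(K <- S) \sum_(L <- S) \sum_(a <- dvs m)
    \sum_(b <- dvs m) if G i a b K L then hop_term f K * hop_term g L else 0)); last first.
  move=> i _; rewrite exchange_big; apply: eq_bigr => K _.
  by rewrite exchange_big.
rewrite [RHS]exchange_big; apply: eq_bigr => K _ /=.
rewrite [RHS]exchange_big; apply: eq_bigr => L _ /=.
case: ifP => [/andP[/eqP KLn /eqP KLm]|KLm]; last first.
  rewrite big1 // => i _; rewrite big1 // => a _; rewrite big1 // => b _.
  case: ifP => // /and5P[/eqP abm /eqP Ki /eqP Ka /eqP Li /eqP Lb].
  by move: KLm; rewrite mdegM mevalM Ki Ka Li Lb abm subnKC ?eqxx // -ltnS.
rewrite mdegM in KLn; rewrite mevalM in KLm.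
have Kn : (mdeg K < n.+1)%N by rewrite ltnS -KLn leq_addr.
rewrite (bigD1 (Ordinal Kn)) //= [X in _ + X]big1 ?addr0 => [|i iK]; last first.
  rewrite big1 // => a _; rewrite big1 // => b _.
  case: ifP => // /and5P[_ /eqP Ki _ _ _].
  by case/eqP: iK; apply: val_inj; rewrite /= Ki.
have Km : meval K \in dvs m by rewrite -KLm; exact: dvs_mull.
have Lm : meval L \in dvs m by rewrite -KLm; exact: dvs_mulr.
rewrite (bigD1_seq _ Km) ?fset_uniq //= [X in _ + X]big1 ?addr0 => [|a aK]; last first.
  rewrite big1 // => b _; case: ifP => // /and5P[_ _ /eqP Ka _ _].
  by rewrite Ka eqxx in aK.
rewrite (bigD1_seq _ Lm) ?fset_uniq //= [X in _ + X]big1 ?addr0 => [|b bL]; last first.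
  by case: ifP => // /and5P[_ _ _ _ /eqP Lb]; rewrite Lb eqxx in bL.
by rewrite /G /= KLm -KLn addKn !eqxx.
Qed.

HB.instance Definition _ := isPreLambda.Build (sps R) sps_hop0 sps_hop1 sps_hopD.

Lemma Exp_sym f : forall s : nat -> nat, bijective s ->
  forall m m' : mon, (forall i, m' (s i) = m i) ->
  \sum_(k \in [set: nat]) hop k f m' = \sum_(k \in [set: nat]) hop k f m.
Proof.
by move=> s sb m m' e; apply: eq_fsbigr => k _; exact: coef_sym sb _ _ e.
Qed.
(* sum_k h_k o f, taken coefficientwise.  To be used for f in Fil^1 only: then
   h_k o f is in Fil^k, so that each coefficient is a finite sum.  (A [\sum_(_ \in _)]
   with infinite support would be 0 by convention.) *)
Definition Exp f : sps R := Sps (@Exp_sym f).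
End PreLambdaSps.

(* Main.v *)
Require Import Defs.
Set Warnings "-notation-overridden,-ambiguous-paths,-notation-incompatible-prefix".
From mathcomp Require Import finmap boolp classical_sets fsbigop monalg perm.
From mathcomp Require Import all_boot all_algebra.
Import GRing.Theory.
Local Open Scope ring_scope.

Set Implicit Arguments.
Unset Strict Implicit.
Unset Printing Implicit Defensive.

(** Because sigma_t(-X) is the inverse of sigma_t(X), inverting a power series
    with constant term 1 gives
      h_n o (-X) = sum over the compositions al of n
                     of (-1)^(length of al) * prod_j (h_(al_j) o X).
    The coefficient of t^m in Exp(X h_1) is prod_i (h_(m_i) o X) [Exp_lin], so
    the coefficient of t^m in Exp(-X h_1) is the sum, over all ways of refining
    every exponent m_i into a composition, of the signed coefficients of
    Exp(X h_1) at the monomials with the refined exponents [antipode_Exp].  The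
    operator [antipode] that does this to any symmetric series is the antipode
    of the quasisymmetric functions.  Its matrix has integer entries, so it
    commutes with every additive map applied to the coefficients
    [sps_map_antipode].  The theorem is therefore the equality of [antipode] with
    omega_tilde [omega_tildeE].

    As omega is specified by its properties, this equality means that
    f |-> antipode (flip f) has them and that nothing else does.  Both follow
    from two facts.

    - A continuous linear operator is determined by its values on the products
      of elementary symmetric functions [eq_on_e], since these span a dense
      subspace.  Multiplicativity, involutivity and uniqueness then only have to
      be checked on such products.

    - The antipode exchanges the products of the h_n with those of the
      (-1)^n e_n [antipode_prod].  A series [mult_series a] with coefficients
      prod_i a(m_i) is sent to [mult_series b], where b is the inverse of the
      power series a [antipode_mult_series].  The product over all i and j of the
      1 / (1 - x_j t_i), for finitely many auxiliary indeterminates x_j, is of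
      this form; extracting its coefficient at a monomial in the x_j gives a
      product of h_n, while the inverse series gives a product of the
      (-1)^n e_n.  The adjunction of the x_j one at a time is the induction of
      [antipode_kernel]. *)

(** * Exponents of a monomial *)

Definition lmon (s : seq nat) : mon :=
  mkcmonom [fsfun i in [fset i | i in iota 0 (size s)]%fset => nth 0%N s i | 0%N].

(** Sorting makes the list a canonical form: it is unchanged by a permutation of
    the variables, so anything defined from it is symmetric. *)
Definition exps (m : mon) : seq nat := sort leq [seq m i | i <- finsupp m].

Lemma lmonE s i : lmon s i = nth 0%N s i.
Proof.
rewrite cmE fsfun_fun; case: imfsetP => [//|h].
rewrite nth_default // leqNgt; apply/negP => si; apply: h.
by exists i => //=; rewrite mem_iota.
Qed.

Lemma perm_exps m : perm_eq (exps m) [seq m i | i <- finsupp m].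
Proof. by rewrite perm_sort. Qed.

Section BigMonomials.
Variables (T : Type) (idx : T) (op : Monoid.com_law idx) (a : nat -> T).
Hypothesis a0 : a 0%N = idx.

(** As [a] is trivial at 0, the variables outside the support may be included or
    left out at will. *)
Lemma big_finsupp (D : {fset nat}) (m : mon) : (finsupp m `<=` D)%fset ->
  \big[op/idx]_(i <- finsupp m) a (m i) = \big[op/idx]_(i <- D) a (m i).
Proof.
move=> mD; apply: big_fset_incl => // i _.
by rewrite -cmE_neq0 negbK => /eqP ->.
Qed.

Lemma big_lmon s :
  \big[op/idx]_(i <- finsupp (lmon s)) a (lmon s i) = \big[op/idx]_(j <- s) a j.
Proof.
rewrite (@big_finsupp [fset i | i in iota 0 (size s)]%fset).
  rewrite (perm_big (iota 0 (size s))); last first.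
    apply: uniq_perm => [||i]; rewrite ?fset_uniq ?iota_uniq //.
    by apply/imfsetP/idP => [[j /= ? ->] //|]; exists i.
  under eq_bigr => i _ do rewrite lmonE.
  by rewrite [RHS](big_nth 0%N) /index_iota subn0.
apply/fsubsetP => i; rewrite -cmE_neq0 lmonE => si; apply/imfsetP; exists i => //=.
rewrite mem_iota leq0n add0n ltnNge; apply: contra si => si.
by rewrite nth_default.
Qed.

Lemma big_exps (m : mon) :
  \big[op/idx]_(i <- finsupp m) a (m i) = \big[op/idx]_(j <- exps m) a j.
Proof. by rewrite (perm_big _ (perm_exps m)) big_map. Qed.
End BigMonomials.

Lemma exps_rename s s' (m : mon) : cancel s s' -> cancel s' s ->
  exps (mrename s s' m) = exps m.
Proof.
move=> sK s'K; apply/perm_sortP; [exact: leq_total|exact: leq_trans|exact: anti_leq|].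
apply: perm_trans (perm_map _ (mrename_supp m sK s'K)) _.
rewrite -map_comp (@eq_map _ _ _ m) // => i /=.
by rewrite mrenameE // sK.
Qed.

Lemma mdeg_lmon s : mdeg (lmon s) = sumn s.
Proof. by rewrite /mdeg (big_lmon _ (a := id)) // sumnE. Qed.

Lemma sumn_exps m : sumn (exps m) = mdeg m.
Proof. by rewrite sumnE -(big_exps _ id). Qed.

Lemma exps_neq0 (m : mon) j : j \in exps m -> j != 0%N.
Proof.
by rewrite (perm_mem (perm_exps m)) => /mapP[i im ->]; rewrite cmE_neq0.
Qed.

Lemma exps_lmon s : perm_eq (exps (lmon s)) [seq j <- s | j != 0%N].
Proof.
apply/permP => a; rewrite count_filter.
have -> : count a (exps (lmon s)) = count (predI a (predC1 0%N)) (exps (lmon s)).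
  by apply: eq_in_count => j /exps_neq0 /= ->; rewrite andbT.
rewrite -!sum1_count !(big_mkcond (predI _ _)).
pose g j := (if predI a (predC1 0%N) j then 1 else 0)%N.
have g0 : g 0%N = 0%N by rewrite /g /= andbF.
by rewrite -(big_exps _ g) (big_lmon _ g0).
Qed.

Lemma size_exps (m : mon) : size (exps m) = #|` finsupp m|%fset.
Proof. by rewrite size_sort size_map. Qed.

(** Variables outside the support only contribute zeros. *)
Lemma exps_pad (m : mon) (D : seq nat) : uniq D -> {subset finsupp m <= D} ->
  perm_eq [seq m i | i <- D] (exps m ++ nseq (size D - size (exps m)) 0%N).
Proof.
move=> Du mD; pose Z := [seq i <- D | i \notin finsupp m].
have DE : perm_eq D (finsupp m ++ Z).
  rewrite -(perm_filterC [in finsupp m] D) perm_cat2r.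
  apply: uniq_perm => [||i]; rewrite ?filter_uniq ?fset_uniq //.
  by rewrite mem_filter andb_idr // => /mD.
apply: perm_trans (perm_map _ DE) _; rewrite map_cat.
apply: perm_cat; first by rewrite perm_sym perm_exps.
rewrite (perm_size DE) size_cat size_exps addKn.
suff -> : [seq m i | i <- Z] = nseq (size Z) 0%N by [].
rewrite -(size_map (fun i => m i) Z); apply/all_pred1P/allP => j /mapP[i].
by rewrite mem_filter -cmE_eq0 => /andP[/eqP mi0 _] -> /=; rewrite mi0.
Qed.

(** Padded with zeros, the exponents of both monomials in the variables t_i with
    i < N are rearrangements of each other; the permutation of these N variables
    extends by the identity to a bijection of nat. *)
Lemma coef_perm (A : comPzRingType) (f : sps A) (m m' : mon) :
  perm_eq (exps m) (exps m') -> f m' = f m.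
Proof.
move=> mm'; pose N := (\max_(i <- finsupp m ++ finsupp m') i).+1.
have lt_N i : i \in finsupp m ++ finsupp m' -> (i < N)%N.
  by move=> im; rewrite ltnS; exact: leq_bigmax_seq.
have mN : {subset finsupp m <= iota 0 N}.
  by move=> i im; rewrite mem_iota lt_N // mem_cat im.
have m'N : {subset finsupp m' <= iota 0 N}.
  by move=> i im; rewrite mem_iota lt_N // mem_cat im orbT.
have /tuple_permP[p pE] : perm_eq [seq m i | i <- iota 0 N] (map_tuple m' (iota_tuple N 0)).
  apply: perm_trans (exps_pad (iota_uniq _ _) mN) _.
  rewrite perm_sym; apply: perm_trans (exps_pad (iota_uniq _ _) m'N) _.
  by rewrite (perm_size mm') perm_cat2r perm_sym.
pose ext (q : {perm 'I_N}) i := oapp (fun j => q j : nat) i (insub i).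
have extK q : cancel (ext q) (ext q^-1%g).
  move=> i; rewrite /ext; case: (insubP _ i) => [j _ <-|iN] /=; first by rewrite valK /= permK.
  by rewrite insubN.
apply: (@coef_sym _ f (ext p)).
  by exists (ext p^-1%g) => //; rewrite -{2}[p]invgK; exact: extK.
move=> i; rewrite /ext; case: insubP => [j _ <-|iN] /=; last first.
  have h (l : mon) : {subset finsupp l <= iota 0 N} -> l i = 0%N.
    move=> lN; apply/eqP/negPn; rewrite cmE_neq0; apply: contra iN => /lN.
    by rewrite mem_iota.
  by rewrite !h.
have := congr1 (fun s => nth 0%N s j) pE.
rewrite (nth_map 0%N) ?size_iota // nth_iota //= add0n => ->.
by rewrite (nth_map j) ?size_enum_ord // nth_ord_enum tnth_map (tnth_nth 0%N) nth_iota.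
Qed.

Lemma coef_lmon (A : comPzRingType) (f : sps A) (m : mon) s :
  0%N \notin s -> perm_eq s (exps m) -> f (lmon s) = f m.
Proof.
move=> s0 sm; apply: coef_perm; rewrite perm_sym (perm_trans (exps_lmon s)) //.
suff -> : [seq j <- s | j != 0%N] = s by [].
by apply/all_filterP/allP => j; apply: contraTneq => ->.
Qed.

(** * The antipode *)

(** The compositions of [n], by their first part [i.+1]; [d] bounds the recursion
    depth, and any [d] with [n <= d] gives all of them. *)
Fixpoint comps_rec d n : seq (seq nat) :=
  if d is d'.+1 then
    if n is n'.+1 then
      flatten [seq [seq i.+1 :: al | al <- comps_rec d' (n' - i)%N] | i <- iota 0 n]
    else [:: [::]]
  else [:: [::]].

Definition comps n := comps_rec n n.

Fixpoint refinements (s : seq nat) : seq (seq nat) :=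
  if s is n :: s' then [seq al ++ be | al <- comps n, be <- refinements s']
  else [:: [::]].

Lemma comps_recS d n : comps_rec d.+1 n.+1 =
  flatten [seq [seq i.+1 :: al | al <- comps_rec d (n - i)%N] | i <- iota 0 n.+1].
Proof. by []. Qed.

Lemma comps_rec_fuel d n : (n <= d)%N -> comps_rec d n = comps n.
Proof.
rewrite /comps; elim/ltn_ind: d n => -[|d] IH [|n] nd //.
rewrite !comps_recS; congr flatten; apply: eq_map => i.
by rewrite (IH d) 1?(IH n) ?leq_subr // (leq_trans (leq_subr _ _)).
Qed.

Lemma compsS n :
  comps n.+1 = flatten [seq [seq i.+1 :: al | al <- comps (n - i)%N] | i <- iota 0 n.+1].
Proof.
rewrite {1}/comps comps_recS; congr flatten; apply: eq_map => i.
by rewrite comps_rec_fuel ?leq_subr.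
Qed.

Lemma sumn_comps n al : al \in comps n -> sumn al = n.
Proof.
elim/ltn_ind: n al => -[|n] IH al; first by rewrite inE => /eqP ->.
rewrite compsS => /flatten_mapP[i]; rewrite mem_iota add0n ltnS => /= ni.
by case/mapP => be /IH bn -> /=; rewrite bn ?ltnS ?leq_subr // addSn subnKC.
Qed.

Lemma sumn_refinements s al : al \in refinements s -> sumn al = sumn s.
Proof.
elim: s al => [|n s IH] al /=; first by rewrite inE => /eqP ->.
by case/allpairsP => -[a b] /= [/sumn_comps an /IH bs ->]; rewrite sumn_cat an bs.
Qed.

(** Here [b] is the inverse of [a] as a power series. *)
Section SignedSums.
Variables (A : comPzRingType) (a b : nat -> A).
Hypothesis a0 : a 0%N = 1.
Hypothesis ab : forall n, \sum_(i < n.+1) a i * b (n - i)%N = (n == 0%N)%:R.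

(** Solving a * b = 1 for b_n gives b_n = - sum_(0 < i <= n) a_i b_(n-i), where i
    is the first part of the composition. *)
Lemma sum_comps n :
  \sum_(al <- comps n) (-1) ^+ size al * \prod_(j <- al) a j = b n.
Proof.
elim/ltn_ind: n => -[|n] IH.
  have := ab 0; rewrite big_ord1 a0 mul1r subnn => ->.
  by rewrite big_seq1 /= big_nil expr0 mul1r.
have := ab n.+1; rewrite big_ord_recl a0 mul1r subn0 /= => /eqP.
rewrite addr_eq0 => /eqP ->.
have iotaE : iota 0 n.+1 = index_iota 0 n.+1 by rewrite /index_iota subn0.
rewrite compsS iotaE big_flatten big_map big_mkord -sumrN.
apply: eq_bigr => i _; rewrite big_map -(IH (n - i)%N) ?ltnS ?leq_subr //.
rewrite mulr_sumr -sumrN; apply: eq_bigr => al _ /=.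
by rewrite big_cons exprS mulN1r mulNr mulrCA.
Qed.

Lemma sum_refinements s :
  \sum_(al <- refinements s) (-1) ^+ size al * \prod_(j <- al) a j =
  \prod_(n <- s) b n.
Proof.
elim: s => [|n s IH] /=; first by rewrite big_seq1 !big_nil expr0 mul1r.
rewrite big_allpairs_dep big_cons -IH -sum_comps mulr_suml; apply: eq_bigr => al _.
rewrite mulr_sumr; apply: eq_bigr => be _.
by rewrite size_cat exprD big_cat /= mulrACA.
Qed.
End SignedSums.

Section Antipode.
Variable A : comPzRingType.
Implicit Types f g : sps A.

Lemma antipode_sym f : forall s : nat -> nat, bijective s ->
  forall m m' : mon, (forall i, m' (s i) = m i) ->
  \sum_(al <- refinements (exps m')) (-1) ^+ size al * f (lmon al) =
  \sum_(al <- refinements (exps m)) (-1) ^+ size al * f (lmon al).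
Proof. by apply: sym_of_rename => s s' sK s'K m; rewrite exps_rename. Qed.
Definition antipode f : sps A := Sps (antipode_sym f).

Lemma antipode_linear : linear antipode.
Proof.
move=> c f g; apply: spsP => m /=; rewrite mulr_sumr -big_split /=.
by apply: eq_bigr => al _; rewrite mulrDr mulrCA.
Qed.

(** Refining the exponents does not change the degree. *)
Lemma antipode_Fil n f : Fil n f -> Fil n (antipode f).
Proof.
move=> fn m mn /=; rewrite big_seq big1 // => al /sumn_refinements alm.
by rewrite fn ?mulr0 // mdeg_lmon alm sumn_exps.
Qed.

Lemma flip_linear : linear (@flip A).
Proof. by move=> c f g; apply: spsP => m /=; rewrite mulrDr mulrCA. Qed.

Lemma flipK : involutive (@flip A).
Proof. by move=> f; apply: spsP => m /=; rewrite mulrA -expr2 sqrr_sign mul1r. Qed.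

Lemma flip_Fil n f : Fil n f -> Fil n (flip f).
Proof. by move=> fn m mn /=; rewrite fn ?mulr0. Qed.

Lemma flip1 : flip 1 = 1 :> sps A.
Proof.
apply: spsP => m /=; case: eqP => [->|_]; last by rewrite mulr0.
by rewrite mdeg1 expr0 mul1r.
Qed.

Lemma flipM f g : flip (f * g) = flip f * flip g.
Proof.
apply: spsP => m /=; rewrite !(convE (D := dvs m)) // mulr_sumr.
apply: eq_bigr => p _; rewrite mulr_sumr; apply: eq_bigr => q _.
case: eqP => [<-|_]; last by rewrite mulr0.
by rewrite mdegM exprD mulrACA.
Qed.

Lemma antipode_flip f : antipode (flip f) = flip (antipode f).
Proof.
apply: spsP => m /=; rewrite mulr_sumr big_seq [RHS]big_seq.
apply: eq_bigr => al /sumn_refinements alm.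
by rewrite mdeg_lmon alm sumn_exps mulrCA.
Qed.
End Antipode.

Lemma sps_map_antipode (A B : comPzRingType) (phi : {additive A -> B}) (f : sps A) :
  sps_map phi (antipode f) = antipode (sps_map phi f).
Proof.
apply: spsP => m /=; rewrite raddf_sum; apply: eq_bigr => al _.
by rewrite -signr_odd -[in RHS]signr_odd; case: odd; rewrite ?mulN1r ?mul1r ?raddfN.
Qed.

(** * Multiplicative series *)

Section MultSeries.
Variable A : comPzRingType.
Implicit Types a b : nat -> A.

Lemma mult_series_sym a : forall s : nat -> nat, bijective s ->
  forall m m' : mon, (forall i, m' (s i) = m i) ->
  \prod_(i <- finsupp m') a (m' i) = \prod_(i <- finsupp m) a (m i).
Proof. by apply: sym_of_rename => s s' sK s'K m; rewrite !big_exps exps_rename. Qed.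
(** The product over i of sum_n a_n t_i^n, when a_0 = 1. *)
Definition mult_series a : sps A := Sps (mult_series_sym a).

(** The product over i of the products of two series in t_i: expanding
    prod_i sum_(j <= m_i) a_j b_(m_i - j) amounts to choosing a divisor of m. *)
Lemma mult_series_conv a b : a 0%N = 1 -> b 0%N = 1 ->
  mult_series (fun n => \sum_(i < n.+1) a i * b (n - i)%N) = mult_series a * mult_series b.
Proof.
move=> a0 b0; apply: spsP => m /=; pose D := finsupp m; pose N := (mdeg m).+1.
have mN i : (m i < N)%N.
  rewrite ltnS; case: (boolP (i \in D)) => [im|]; last first.
    by rewrite -cmE_neq0 negbK => /eqP ->.
  by rewrite /mdeg (big_fsetD1 i) //= leq_addr.
(* A divisor of m, given by its exponents on the support of m. *)
pose mk (k : {ffun D -> 'I_N}) : mon := mkcmonom [fsfun i : D => (k i : nat) | 0%N].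
have mkE k (u : D) : mk k (val u) = k u by rewrite cmE fsfun_ffun valK.
have mk0 k i : i \notin D -> mk k i = 0%N by move=> iD; rewrite cmE fsfun_ffun insubN.
pose Q (u : D) := [pred j : 'I_N | (j < (m (val u)).+1)%N].
have mk_le k i : k \in family Q -> (mk k i <= m i)%N.
  move=> /familyP kQ; case: (boolP (i \in D)) => [iD|/mk0 -> //].
  have -> : i = val (Sub i iD : D) by rewrite SubK.
  by rewrite mkE; have := kQ (Sub i iD); rewrite !inE ltnS.
have supp_le (p : mon) : (forall i, p i <= m i)%N -> (finsupp p `<=` D)%fset.
  move=> pm; apply/fsubsetP => i; rewrite -!cmE_neq0 -!lt0n => p0.
  exact: leq_trans p0 (pm i).
pose r := [seq (mk k, divcm m (mk k)) | k <- enum (family Q)].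
rewrite /conv (fsbigE r) /=; first last.
- move=> [p q] /= pq; case/negP; apply/mapP.
  have pm i : (p i <= m i)%N by rewrite -pq mmulE leq_addr.
  exists [ffun u => inord (p (val u))].
    rewrite mem_enum; apply/familyP => u; rewrite ffunE !inE ltnS inordK //.
    exact: leq_ltn_trans (pm _) (mN _).
  have <- : p = mk [ffun u => inord (p (val u))].
    apply: cmonomP => i; case: (boolP (i \in D)) => iD.
      have -> : i = val (Sub i iD : D) by rewrite SubK.
      by rewrite mkE ffunE inordK // (leq_ltn_trans (pm _) (mN _)).
    rewrite mk0 //; apply/eqP; rewrite cmE_eq0.
    by apply: contra iD; apply/fsubsetP/supp_le.
  by congr pair; apply: cmonomP => i; rewrite divcmE -pq mmulE addKn.
- move=> p /= /mapP[k]; rewrite mem_enum => kQ -> /=; apply: cmonomP => i.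
  by rewrite mmulE divcmE subnKC // mk_le.
- rewrite map_inj_uniq ?enum_uniq // => k k' [e _].
  by apply/ffunP => u; apply: val_inj; rewrite /= -!mkE e.
rewrite big_seq_fsetE /=.
under eq_bigr => u _ do
  rewrite (big_ord_widen N (fun i => a i * b (m (val u) - i)%N)) ?mN //.
rewrite (bigA_distr_big_dep Q (fun u i => a i * b (m (val u) - i)%N)).
rewrite big_map big_enum_cond /=.
rewrite [RHS](eq_bigl [in family Q]); last first.
  move=> k; rewrite andb_idr // => kQ; apply/mem_set; apply: cmonomP => i /=.
  by rewrite mmulE divcmE subnKC // mk_le.
apply: eq_bigr => k kQ.
have sD : (finsupp (divcm m (mk k)) `<=` D)%fset.
  by apply: supp_le => i; rewrite divcmE leq_subr.
rewrite (big_finsupp _ a0 (supp_le _ (fun i => mk_le k i kQ))) (big_finsupp _ b0 sD).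
rewrite -big_split big_seq_fsetE /=; apply: eq_bigr => u _.
by rewrite divcmE mkE.
Qed.

Lemma mult_series_unit a : (forall n, a n = (n == 0%N)%:R) -> mult_series a = 1.
Proof.
move=> aE; apply: spsP => m /=; have [->|m1] := eqVneq m mone.
  by rewrite mdom1 big_seq_fset0.
rewrite -mdeg_eq0 /mdeg in m1.
have [fm|[i im]] := fset_0Vmem (finsupp m).
  by rewrite fm big_seq_fset0 in m1.
by rewrite (big_fsetD1 i) //= aE cmE_eq0 im mul0r.
Qed.

Lemma antipode_mult_series_conv a b : a 0%N = 1 ->
  (forall n, \sum_(i < n.+1) a i * b (n - i)%N = (n == 0%N)%:R) ->
  antipode (mult_series a) = mult_series b.
Proof.
move=> a0 ab; apply: spsP => m; rewrite /= big_exps -(sum_refinements a0 ab).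
by apply: eq_bigr => al _; rewrite (big_lmon _ a0).
Qed.

(** The series in the single variable t_0 are read off at the monomials
    [lmon [:: n]]: the two sequences are inverse to each other because the two
    symmetric series are. *)
Lemma antipode_mult_series a b : a 0%N = 1 -> b 0%N = 1 -> mult_series a * mult_series b = 1 ->
  antipode (mult_series a) = mult_series b.
Proof.
move=> a0 b0 ab1; apply: antipode_mult_series_conv => // n; rewrite -mult_series_conv // in ab1.
have := congr1 (fun f : sps A => f (lmon [:: n])) ab1.
rewrite /= (big_lmon _ (a := fun n => \sum_(i < n.+1) a i * b (n - i)%N)); last first.
  by rewrite big_ord1 a0 b0 mulr1.
by rewrite big_seq1 -mdeg_eq0 mdeg_lmon /= addn0 => ->.
Qed.
End MultSeries.

(** * The antipode of products of h and e *)

Section MapMorphism.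
Variables (A B : comPzRingType) (iota : {rmorphism A -> B}).

Lemma sps_map1 : sps_map iota 1 = 1.
Proof. by apply: spsP => m /=; rewrite rmorph_nat. Qed.

Lemma sps_mapM (f g : sps A) : sps_map iota (f * g) = sps_map iota f * sps_map iota g.
Proof.
apply: spsP => m /=; rewrite !(convE (D := dvs m)) // rmorph_sum.
apply: eq_bigr => p _; rewrite rmorph_sum; apply: eq_bigr => q _.
by case: ifP; rewrite ?rmorphM ?rmorph0.
Qed.

Lemma sps_map_mult_series (a : nat -> A) : sps_map iota (mult_series a) = mult_series (iota \o a).
Proof. by apply: spsP => m /=; rewrite rmorph_prod. Qed.
End MapMorphism.

(** The series 1 / (1 - x t) and its inverse 1 - x t, where x is ['X]; their
    multiplicative series are sum_n x^n h_n and sum_n (-x)^n e_n. *)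
Section OneVariable.
Variable B : comNzRingType.

Definition geom (n : nat) : {poly B} := 'X^n.
Definition geom_inv (n : nat) : {poly B} :=
  if n is n'.+1 then if n' is 0%N then - 'X else 0 else 1.

Lemma mult_series_geom_inv : mult_series geom * mult_series geom_inv = 1.
Proof.
rewrite -mult_series_conv //; apply: mult_series_unit => -[|n]; first by rewrite big_ord1 mulr1.
rewrite !big_ord_recr /= subnn subSnn mulr1 big1 => [|i _].
  by rewrite add0r mulrN /geom -exprSr addNr.
by case: i => i /= ni; rewrite subSn 1?ltnW // -(subnSK ni) mulr0.
Qed.

Lemma coef_mult_series_geom (q : mon) n : (mult_series geom q)`_n = (mdeg q == n)%:R.
Proof. by rewrite /= prodrXr -/(mdeg q) coefXn eq_sym. Qed.

Lemma mult_series_geom_invE (q : mon) :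
  mult_series geom_inv q = (`[< forall i, (q i <= 1)%N >])%:R * (-1) ^+ mdeg q * 'X^(mdeg q).
Proof.
rewrite /=; case: asboolP => [q1|nq1].
  rewrite mul1r -exprMn mulN1r -prodrXr; apply: eq_bigr => i _.
  by case: (q i) (q1 i) => [|[|]].
rewrite !mul0r; have [i iq] : exists i, (1 < q i)%N.
  by apply: contrapT => h; apply: nq1 => i; rewrite leqNgt; apply/negP => ?; apply: h; exists i.
have im : i \in finsupp q by rewrite -cmE_neq0; case: (q i) iq.
by rewrite (big_fsetD1 i) //=; case: (q i) iq => [|[|n]] //; rewrite mul0r.
Qed.
End OneVariable.

Section Kernel.
Variable A : comPzRingType.

(** Extraction of the coefficient of x^n from a product f * K in which x occurs
    only in K, with coefficient k there. *)
Lemma sps_map_coef_mul (B : comNzRingType) (phi : {additive B -> A}) n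
    (f : sps B) (K : sps {poly B}) (k : sps A) :
  (forall q x, phi (x * (K q)`_n) = phi x * k q) ->
  sps_map (phi \o coefp n) (sps_map polyC f * K) = sps_map phi f * k.
Proof.
move=> Kk; apply: spsP => m; rewrite /= !(convE (D := dvs m)) //.
rewrite coef_sum raddf_sum; apply: eq_bigr => p _.
rewrite coef_sum raddf_sum; apply: eq_bigr => q _ /=.
by case: ifP => _; rewrite ?coef0 ?raddf0 // coefCM Kk.
Qed.

(** The coefficients of e_n and h_n are 0 and 1, so up to sign they pass through
    [phi]. *)
Lemma additive_sign_nat (B : pzRingType) (phi : {additive B -> A}) x k (c : bool) :
  phi (x * ((-1) ^+ k * c%:R)) = phi x * ((-1) ^+ k * c%:R).
Proof.
rewrite -signr_odd -[in RHS]signr_odd.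
by case: odd; case: c; rewrite ?expr1 ?expr0 ?mul1r ?mulr0 ?mulN1r ?mulr1 ?mulrN1 ?raddfN ?raddf0.
Qed.

(** Each h_n is absorbed into [mult_series a] by passing to polynomials in a new
    indeterminate x: the product of [mult_series a] with sum_n x^n h_n is again
    multiplicative, [phi] becomes the extraction of the coefficient of x^n
    followed by [phi], and the inverse series acquires the factor
    sum_n (-x)^n e_n.  At the end of the induction no h_n is left and
    [antipode_mult_series] applies. *)
Lemma antipode_kernel s (B : comNzRingType) (phi : {additive B -> A}) (a b : nat -> B) :
  a 0%N = 1 -> b 0%N = 1 -> mult_series a * mult_series b = 1 ->
  antipode (sps_map phi (mult_series a) * \prod_(n <- s) hsym A n) =
    sps_map phi (mult_series b) * \prod_(n <- s) flip (elsym A n) /\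
  antipode (sps_map phi (mult_series b) * \prod_(n <- s) flip (elsym A n)) =
    sps_map phi (mult_series a) * \prod_(n <- s) hsym A n.
Proof.
elim: s B phi a b => [|n s IH] B phi a b a0 b0 ab1.
  rewrite !big_nil !mulr1 -!sps_map_antipode.
  by rewrite (antipode_mult_series a0 b0 ab1) (antipode_mult_series b0 a0) // mulrC.
rewrite !big_cons !mulrA.
pose a' j := \sum_(i < j.+1) (a i)%:P * geom B (j - i)%N.
pose b' j := \sum_(i < j.+1) (b i)%:P * geom_inv B (j - i)%N.
have aE : mult_series a' = sps_map polyC (mult_series a) * mult_series (geom B).
  by rewrite sps_map_mult_series -mult_series_conv //= a0.
have bE : mult_series b' = sps_map polyC (mult_series b) * mult_series (geom_inv B).
  by rewrite sps_map_mult_series -mult_series_conv //= b0.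
have ha : sps_map (phi \o coefp n) (mult_series a') = sps_map phi (mult_series a) * hsym A n.
  rewrite aE; apply: sps_map_coef_mul => q x.
  by rewrite coef_mult_series_geom -[_%:R]mul1r (additive_sign_nat _ _ 0) expr0 mul1r.
have hb : sps_map (phi \o coefp n) (mult_series b') = sps_map phi (mult_series b) * flip (elsym A n).
  rewrite bE; apply: sps_map_coef_mul => q x.
  rewrite mult_series_geom_invE /=.
  have -> : (`[< mdeg q = n /\ forall i, (q i <= 1)%N >] =
             `[< forall i, (q i <= 1)%N >] && (mdeg q == n))%bool.
    by apply/asboolP/andP => [[-> /asboolP ->]|[/asboolP ? /eqP ?]].
  rewrite -additive_sign_nat; congr (phi (x * _)).
  case: asbool => /=; last by rewrite !mul0r coef0 mulr0.
  rewrite mul1r -signr_odd -[in RHS]signr_odd.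
  by case: odd; rewrite ?mulN1r ?mul1r ?coefN coefXn eq_sym.
rewrite -ha -hb; apply: IH.
- by rewrite /a' big_ord1 a0 mulr1.
- by rewrite /b' big_ord1 b0 mulr1.
- by rewrite aE bE mulrACA mult_series_geom_inv mulr1 -sps_mapM ab1 sps_map1.
Qed.

(** The integers serve as a nonzero base ring over which polynomials can be
    formed, whatever [A] is. *)
Lemma antipode_prod s :
  antipode (\prod_(n <- s) hsym A n) = flip (\prod_(n <- s) elsym A n) /\
  antipode (flip (\prod_(n <- s) elsym A n)) = \prod_(n <- s) hsym A n.
Proof.
pose d n : int := (n == 0%N)%:R.
have d1 : mult_series d = 1 by apply: mult_series_unit.
have dE : sps_map (intr : {additive int -> A}) (mult_series d) = 1.
  by rewrite d1; apply: spsP => m /=; case: eqP.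
have := @antipode_kernel s _ (intr : {additive int -> A}) d d erefl erefl.
rewrite dE !mul1r d1 mulr1 => /(_ erefl).
have -> : \prod_(n <- s) flip (elsym A n) = flip (\prod_(n <- s) elsym A n).
  by apply/esym/big_morph; [exact: flipM|exact: flip1].
by [].
Qed.
End Kernel.

(** * Density of the polynomials in the elementary symmetric functions *)

Lemma mdivcmK (m p : mon) : (forall i, p i <= m i)%N -> mmul p (divcm m p) = m.
Proof. by move=> pm; apply: cmonomP => i; rewrite mmulE divcmE subnKC. Qed.

Definition supp_mon (m : mon) : mon := mkcmonom [fsfun i in finsupp m => 1%N | 0%N].

Lemma supp_monE m i : supp_mon m i = (m i != 0%N).
Proof. by rewrite cmE fsfun_fun cmE_neq0; case: ifP. Qed.

Lemma finsupp_supp_mon m : finsupp (supp_mon m) = finsupp m.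
Proof. by apply/fsetP => i; rewrite -cmE_neq0 supp_monE eqb0 negbK cmE_neq0. Qed.

Lemma supp_mon_le m i : (supp_mon m i <= m i)%N.
Proof. by rewrite supp_monE; case: (m i). Qed.

Lemma supp_le_mdeg (m : mon) : (#|` finsupp m| <= mdeg m)%N.
Proof.
rewrite -sum1_size /mdeg big_seq [leqRHS]big_seq; apply: leq_sum => i.
by rewrite -cmE_neq0 lt0n.
Qed.

Lemma mdeg_squarefree (m : mon) : (forall i, m i <= 1)%N -> mdeg m = #|` finsupp m|.
Proof.
move=> m1; rewrite -sum1_size /mdeg big_seq [RHS]big_seq; apply: eq_bigr => i.
by rewrite -cmE_neq0; case: (m i) (m1 i) => [|[|]].
Qed.

Section Span.
Variable A : comPzRingType.
Implicit Types f g h : sps A.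

Lemma spsDE f g m : (f + g) m = f m + g m.
Proof. by []. Qed.

Lemma spsBE f g m : (f - g) m = f m - g m.
Proof. by rewrite -[in RHS]mulN1r. Qed.

(** Each monomial of e_p involves p variables, and those of a multiple of e_p at
    least as many. *)
Lemma coef_elsymM_lt p f (m : mon) : (#|` finsupp m| < p)%N -> (elsym A p * f) m = 0.
Proof.
move=> mp; rewrite /= (convE (D := dvs m)) // big1 // => a _; rewrite big1 // => b _.
case: eqP => // abm; case: asboolP => [[ap a1]|]; last by rewrite mul0r.
move: mp; rewrite -abm mdomD -ap mdeg_squarefree // ltnNge fsubset_leq_card //.
exact: fsubsetUl.
Qed.

(** The only monomial of e_p dividing m is then the product of all the variables
    of m. *)
Lemma coef_elsymM p f (m : mon) : #|` finsupp m| = p ->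
  (elsym A p * f) m = f (divcm m (supp_mon m)).
Proof.
move=> mp; rewrite /= (convE (D := dvs m)) //.
have le_dvs (d : mon) : (forall i, d i <= m i)%N -> d \in dvs m.
  by move=> dm; rewrite mem_dvs; apply/asboolP.
have im : supp_mon m \in dvs m by apply: le_dvs => i; exact: supp_mon_le.
have dm : divcm m (supp_mon m) \in dvs m.
  by apply: le_dvs => i; rewrite divcmE leq_subr.
have i1 i : (supp_mon m i <= 1)%N by rewrite supp_monE; case: eqP.
rewrite (bigD1_seq _ im) ?fset_uniq //= (bigD1_seq _ dm) ?fset_uniq //=.
rewrite mdivcmK; last exact: supp_mon_le.
rewrite eqxx asboolT ?mul1r; last by rewrite mdeg_squarefree // finsupp_supp_mon.
rewrite [X in _ + X + _]big1 ?addr0 => [|b bm]; last first.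
  case: eqP => // ibm; case/eqP: bm; apply: cmonomP => i.
  by have := mmulE (supp_mon m) b i; rewrite ibm divcmE => ->; rewrite addKn.
rewrite [X in _ + X]big1 ?addr0 // => a am; rewrite big1 // => b _.
case: eqP => // abm; case: asboolP => [[ap a1]|]; last by rewrite mul0r.
case/eqP: am; apply: cmonomP => i; rewrite supp_monE.
have /eqP am : finsupp a == finsupp m.
  by rewrite eqEfcard -abm mdomD fsubsetUl -mdomD abm mp -ap mdeg_squarefree //=.
by rewrite cmE_neq0 -am -cmE_neq0; case: (a i) (a1 i) => [|[|]].
Qed.

Lemma pad_support_sym f p : forall s : nat -> nat, bijective s ->
  forall m m' : mon, (forall i, m' (s i) = m i) ->
  f (lmon ([seq j.+1 | j <- exps m'] ++ nseq (p - size (exps m')) 1%N)) =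
  f (lmon ([seq j.+1 | j <- exps m] ++ nseq (p - size (exps m)) 1%N)).
Proof. by apply: sym_of_rename => s s' sK s'K m; rewrite exps_rename. Qed.
(** The series g such that e_p g agrees with f at the monomials in exactly p
    variables: if d has at most p variables, the coefficient of g at d is that of
    f at d times p variables that include those of d.  Adding 1 to p exponents of d, some of them zero,
    yields the list in the definition. *)
Definition pad_support f p : sps A := Sps (pad_support_sym f p).

Lemma pad_supportE f (m : mon) p : #|` finsupp m| = p ->
  pad_support f p (divcm m (supp_mon m)) = f m.
Proof.
move=> mp; set d := divcm m (supp_mon m); apply: coef_lmon.
  by rewrite mem_cat negb_or; apply/andP; split; [apply/mapP => -[]|rewrite mem_nseq andbF].
have dS i : i \in finsupp m -> (d i).+1 = m i.
  by rewrite divcmE supp_monE -cmE_neq0; case: (m i) => // k _; rewrite subn1.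
have dm : {subset finsupp d <= finsupp m}.
  by move=> i; rewrite -!cmE_neq0 divcmE; apply: contra => /eqP ->.
have := perm_map S (exps_pad (fset_uniq _) dm).
rewrite map_cat map_nseq mp -map_comp perm_sym => /permPl ->.
suff -> : [seq (S \o d) i | i <- finsupp m] = [seq m i | i <- finsupp m].
  by rewrite perm_sym perm_exps.
by apply/eq_in_map => i; exact: dS.
Qed.

Inductive e_span : sps A -> Prop :=
| e_span0 : e_span 0
| e_spanDZ a s f : e_span f -> e_span (a *: \prod_(n <- s) elsym A n + f).

Lemma e_spanD f g : e_span f -> e_span g -> e_span (f + g).
Proof.
move=> ff gg; elim: ff => [|a s h _ IH]; first by rewrite add0r.
by rewrite -addrA; apply: e_spanDZ.
Qed.

Lemma spsZAl a f g : a *: f * g = a *: (f * g).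
Proof.
apply: spsP => m; rewrite /= !(convE (D := dvs m)) // mulr_sumr.
apply: eq_bigr => p _; rewrite mulr_sumr; apply: eq_bigr => q _.
by case: eqP; rewrite ?mulr0 ?mulrA.
Qed.

Lemma e_spanM n f : e_span f -> e_span (elsym A n * f).
Proof.
elim=> [|a s g _ IH]; first by rewrite mulr0; exact: e_span0.
rewrite mulrDr mulrC spsZAl [X in a *: X]mulrC.
have <- : \prod_(k <- n :: s) elsym A k = elsym A n * \prod_(k <- s) elsym A k.
  exact: big_cons.
exact: e_spanDZ.
Qed.

(** Fundamental theorem of symmetric functions, the generation part.  By induction
    on p, f can be matched at the monomials in at most p variables: a correction
    e_(p+1) h changes nothing there, and h, of smaller degree, can be chosen to
    correct the monomials in p + 1 variables.  A monomial of degree n has at most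
    n variables. *)
Lemma e_span_homog n f : exists g, [/\ e_span g,
  forall m, mdeg m = n -> g m = f m & forall m, mdeg m <> n -> g m = 0].
Proof.
elim/ltn_ind: n f => -[|n] IH f.
  exists (f mone *: \prod_(k <- [::]) elsym A k + 0).
  rewrite big_nil addr0; split.
  - by rewrite -[X in e_span X]addr0 -(big_nil 1 *%R xpredT (elsym A)); do 2!constructor.
  - by move=> m /mdeg_eq0I -> /=; rewrite eqxx mulr1.
  - by move=> m /eqP; rewrite mdeg_eq0 => /negPf /= ->; rewrite mulr0.
suff /(_ n.+1)[g [gs gf g0]] : forall p, exists g, [/\ e_span g,
    forall m, mdeg m = n.+1 -> (#|` finsupp m| <= p)%N -> g m = f m
    & forall m, mdeg m <> n.+1 -> g m = 0].
  by exists g; split=> // m mn; apply: gf => //; rewrite -mn supp_le_mdeg.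
elim=> [|p [g [gs gf g0]]].
  exists 0; split=> // [|m mn]; first exact: e_span0.
  by rewrite leqn0 cardfs_eq0 => /eqP m0; move: mn; rewrite /mdeg m0 big_seq_fset0.
have [np|pn] := ltnP n p.
  exists g; split=> // m mn _; apply: gf => //.
  by apply: leq_trans np; rewrite -mn supp_le_mdeg.
have [h [hs hf h0]] := IH (n - p)%N (leq_ltn_trans (leq_subr _ _) (ltnSn _))
  (pad_support (f - g) p.+1).
exists (g + elsym A p.+1 * h); split.
- by apply: e_spanD => //; exact: e_spanM.
- move=> m mn; rewrite leq_eqVlt ltnS => /orP[/eqP mp|mp]; last first.
    by rewrite spsDE coef_elsymM_lt ?ltnS // addr0 gf.
  rewrite spsDE coef_elsymM // hf ?pad_supportE //; first by rewrite spsBE addrC subrK.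
  have := mdivcmK (supp_mon_le m) => /(congr1 (@mdeg _)).
  rewrite mdegM mn mdeg_squarefree ?finsupp_supp_mon ?mp => [|i]; last by rewrite supp_monE; case: eqP.
  by rewrite addSn => -[<-]; rewrite addKn.
- move=> m mn; rewrite spsDE g0 // add0r /= (convE (D := dvs m)) //.
  rewrite big1 // => a _; rewrite big1 // => b _; case: eqP => // abm.
  case: asboolP => [[ap _]|]; last by rewrite mul0r.
  rewrite h0 ?mulr0 // => bn; apply: mn.
  by rewrite -abm mdegM ap bn addSn subnKC.
Qed.

Lemma e_span_dense n f : exists2 g, e_span g & Fil n (f - g).
Proof.
elim: n => [|n [g gs fg]]; first by exists 0; [exact: e_span0|].
have [h [hs hf h0]] := e_span_homog n (f - g).
exists (g + h); first exact: e_spanD.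
move=> m; rewrite ltnS leq_eqVlt opprD addrA spsBE => /orP[/eqP mn|mn].
  by rewrite hf // subrr.
by rewrite fg // h0 ?subr0 // => mn'; rewrite mn' ltnn in mn.
Qed.

Definition continuous_Fil (u : sps A -> sps A) :=
  forall n, exists p, forall f, Fil p f -> Fil n (u f).

Lemma eq_on_e (u v : sps A -> sps A) : linear u -> linear v ->
  continuous_Fil u -> continuous_Fil v ->
  (forall s, u (\prod_(n <- s) elsym A n) = v (\prod_(n <- s) elsym A n)) ->
  u =1 v.
Proof.
move=> ul vl uc vc uv f.
have lin0 (w : sps A -> sps A) : linear w -> w 0 = 0.
  by move=> wl; have := wl (-1) 0 0; rewrite !scaleN1r !addNr.
have uv_span g : e_span g -> u g = v g.
  by elim=> [|a s h _ IH]; [rewrite !lin0|rewrite ul vl uv IH].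
apply: spsP => m; have [p1 up] := uc (mdeg m).+1; have [p2 vp] := vc (mdeg m).+1.
have [g gs fg] := e_span_dense (maxn p1 p2) f.
have linB (w : sps A -> sps A) : linear w -> w f = w (f - g) + w g.
  by move=> wl; have := wl 1 (f - g) g; rewrite !scale1r subrK.
rewrite (linB u) // (linB v) // (uv_span g) //.
have h1 : Fil p1 (f - g) by move=> q qp; apply: fg; rewrite leq_max qp.
have h2 : Fil p2 (f - g) by move=> q qp; apply: fg; rewrite leq_max qp orbT.
by rewrite !spsDE (up _ h1) // (vp _ h2).
Qed.

Lemma Fil_mul n f g : Fil n g -> Fil n (f * g).
Proof.
move=> gn m mn; rewrite /= (convE (D := dvs m)) // big1 // => a _.
rewrite big1 // => b _; case: eqP => // abm; rewrite gn ?mulr0 //.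
by apply: leq_ltn_trans mn; rewrite -abm mdegM leq_addl.
Qed.
End Span.

(** * Identification of omega *)

Section Omega.
Variable A : comPzRingType.
Implicit Types f g : sps A.

Definition omega_fun f : sps A := antipode (flip f).

Lemma omega_fun_linear : linear omega_fun.
Proof. by move=> a f g; rewrite /omega_fun flip_linear antipode_linear. Qed.

Lemma omega_fun_Fil n f : Fil n f -> Fil n (omega_fun f).
Proof. by move=> fn; apply/antipode_Fil/flip_Fil. Qed.

Lemma omega_fun_e s : omega_fun (\prod_(n <- s) elsym A n) = \prod_(n <- s) hsym A n.
Proof. by case: (antipode_prod A s). Qed.

Lemma omega_fun_h s : omega_fun (\prod_(n <- s) hsym A n) = \prod_(n <- s) elsym A n.
Proof. by case: (antipode_prod A s) => h _; rewrite /omega_fun antipode_flip h flipK. Qed.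

Lemma mul_linear f : linear (fun g => f * g).
Proof. by move=> a g h; rewrite mulrDr [f * (a *: g)]mulrC spsZAl [g * f]mulrC. Qed.

(** Both sides are continuous and linear in f and in g, so that f and g may be
    taken to be products of elementary symmetric functions. *)
Lemma omega_funM f g : omega_fun (f * g) = omega_fun f * omega_fun g.
Proof.
have [wl wc] := (omega_fun_linear, omega_fun_Fil).
apply: (@eq_on_e A (fun g => omega_fun (f * g)) (fun g => omega_fun f * omega_fun g)).
- by move=> a u v; rewrite mul_linear wl.
- by move=> a u v; rewrite wl mul_linear.
- by move=> n; exists n => u un; apply/wc/Fil_mul.
- by move=> n; exists n => u un; apply/Fil_mul/wc.
move=> t; rewrite [f * _]mulrC [omega_fun f * _]mulrC.
apply: (@eq_on_e A (fun f => omega_fun (\prod_(n <- t) elsym A n * f))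
  (fun f => omega_fun (\prod_(n <- t) elsym A n) * omega_fun f)).
- by move=> a u v; rewrite mul_linear wl.
- by move=> a u v; rewrite wl mul_linear.
- by move=> n; exists n => u un; apply/wc/Fil_mul.
- by move=> n; exists n => u un; apply/Fil_mul/wc.
by move=> s; rewrite -big_cat !omega_fun_e big_cat.
Qed.

Lemma is_omega_fun : is_omega omega_fun.
Proof.
have [wl wc] := (omega_fun_linear, omega_fun_Fil).
split=> //.
- split; last exact: omega_funM.
  by have := omega_fun_e [::]; rewrite !big_nil.
- apply: (@eq_on_e A (fun f => omega_fun (omega_fun f)) id) => //.
  + by move=> a u v; rewrite !wl.
  + by move=> n; exists n => u un; apply/wc/wc.
  + by move=> n; exists n.
  + by move=> s; rewrite omega_fun_e omega_fun_h.
- by move=> i; have := omega_fun_e [:: i]; rewrite !big_seq1.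
- by move=> i; have := omega_fun_h [:: i]; rewrite !big_seq1.
- by move=> n; exists n => f; exact: wc.
Qed.

Lemma omegaE : @omega A = omega_fun.
Proof.
apply: xget_unique; first exact: is_omega_fun.
move=> w [wl [w1 wM] _ we _ wc]; apply/funext; apply: eq_on_e => //.
- exact: omega_fun_linear.
- by move=> n; exists n => f; exact: omega_fun_Fil.
by move=> s; rewrite omega_fun_e (big_morph w wM w1); apply: eq_bigr => n _; exact: we.
Qed.

Lemma omega_tildeE f : omega_tilde f = antipode f.
Proof. by rewrite /omega_tilde omegaE /omega_fun flipK. Qed.
End Omega.

(** * The exponential of X h_1 *)

Section Exponential.
Variable R : preLambdaRingType.

(** That is, sigma_t(0) = 1: it is an idempotent series with constant term 1. *)
Lemma hop_0 n : hop n (0 : R) = (n == 0%N)%:R.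
Proof.
elim/ltn_ind: n => -[|n] IH; first exact: hop0.
have := hopD n.+1 (0 : R) 0; rewrite addr0 big_ord_recl big_ord_recr /= hop0 mul1r.
rewrite /bump add1n subnn hop0 mulr1 big1 => [|i _]; last by rewrite IH ?mul0r //= ltnS ltn_ord.
by rewrite add0r subn0 => /eqP; rewrite -subr_eq0 opprD addNKr oppr_eq0 => /eqP.
Qed.

(** The multiset of variables whose product is [m]; the sum picks the exponent of
    the variable [I] in [m]. *)
Definition var_mset (m : mon) : {cmonom mon} :=
  mkcmonom [fsfun I in [fset (ucm i : mon) | i in finsupp m]%fset =>
    (\sum_(j <- finsupp m) m j * (I : mon) j)%N | 0%N].

Lemma var_msetE m i : var_mset m (ucm i) = m i.
Proof.
rewrite cmE fsfun_fun; case: imfsetP => [[j /= jm ij]|im].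
  have -> : i = j by apply/eqP; have := cmU i j; rewrite ij cmUU; case: eqP.
  rewrite (big_fsetD1 j) //= cmUU muln1 big_seq big1 ?addn0 // => k.
  by rewrite in_fsetD1 eq_sym cmU => /andP[/negPf -> _]; rewrite muln0.
apply/esym/eqP; rewrite cmE_eq0; apply/negP => i_m; apply: im.
by exists i.
Qed.

Lemma finsupp_var_mset m :
  finsupp (var_mset m) = [fset (ucm i : mon) | i in finsupp m]%fset.
Proof.
apply/fsetP => I; apply/idP/imfsetP => [|[i /= im ->]]; last first.
  by rewrite -cmE_neq0 var_msetE cmE_neq0.
by rewrite -cmE_neq0 cmE fsfun_fun; case: imfsetP.
Qed.

Lemma ucm_inj : injective (fun i : nat => ucm i : mon).
Proof. by move=> i j ij; apply/eqP; have := cmU i j; rewrite ij cmUU; case: eqP. Qed.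

Lemma big_var_mset (T : Type) (idx : T) (op : Monoid.com_law idx) m (F : mon -> T) :
  \big[op/idx]_(I <- finsupp (var_mset m)) F I =
  \big[op/idx]_(i <- finsupp m) F (ucm i).
Proof. by rewrite finsupp_var_mset big_imfset //= => i j _ _; exact: ucm_inj. Qed.

Lemma mdeg_var_mset m : mdeg (var_mset m) = mdeg m.
Proof. by rewrite /mdeg big_var_mset; apply: eq_bigr => i _; rewrite var_msetE. Qed.

Lemma meval_var_mset m : meval (var_mset m) = m.
Proof.
apply: cmonomP => i; rewrite (mevalE _ (fsubset_refl _)) big_var_mset.
under eq_bigr => j _ do rewrite var_msetE cmU.
case: (boolP (i \in finsupp m)) => im.
  rewrite (big_fsetD1 i) //= eqxx muln1 big_seq big1 ?addn0 // => k.
  by rewrite in_fsetD1 => /andP[/negPf -> _]; rewrite muln0.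
rewrite big_seq big1 => [|k km]; last by case: eqP km im => [-> ->|]; rewrite ?muln0.
by apply/esym/eqP; rewrite cmE_eq0.
Qed.

Lemma mon_deg1 (m : mon) : mdeg m = 1%N -> exists i, m = ucm i.
Proof.
move=> m1; have [i im] : exists i, i \in finsupp m.
  case: (fset_0Vmem (finsupp m)) => [m0|[i im]]; last by exists i.
  by move: m1; rewrite /mdeg m0 big_seq_fset0.
exists i; have mE : mmul (ucm i) (divcm m (ucm i)) = m.
  by apply: mdivcmK => j; rewrite cmU; case: eqP => // <-; rewrite lt0n cmE_neq0.
move: m1; rewrite -{1}mE mdegM mdegU -[RHS]addn0 => /addnI /mdeg_eq0I d1.
by rewrite -mE d1 mulm1.
Qed.

(** A variable contributes to no exponent of the product but its own. *)
Lemma var_mset_meval (K : {cmonom mon}) :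
  (forall I, I \in finsupp K -> mdeg I = 1%N) -> K = var_mset (meval K).
Proof.
move=> K1; have KE i : meval K i = K (ucm i).
  rewrite (mevalE (D := finsupp K `|` [fset (ucm i : mon)])%fset) ?fsubsetUl //.
  rewrite (big_fsetD1 (ucm i : mon)) /=; last by rewrite in_fsetU in_fset1 eqxx orbT.
  rewrite cmUU muln1 big_seq big1 ?addn0 // => I.
  rewrite in_fsetD1 in_fsetU in_fset1 => /andP[/negPf Ii]; rewrite Ii orbF => IK.
  have [j Ij] := mon_deg1 (K1 _ IK); rewrite Ij cmU.
  by have [ji|_] := eqVneq j i; rewrite ?muln0 //; move: Ii; rewrite Ij ji eqxx.
apply: cmonomP => I; have [I1|I1] := eqVneq (mdeg I) 1%N.
  by have [i ->] := mon_deg1 I1; rewrite var_msetE KE.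
have out (L : {cmonom mon}) :
    (forall J, J \in finsupp L -> mdeg J = 1%N) -> L I = 0%N.
  by move=> L1; apply/eqP; rewrite cmE_eq0; apply: contra I1 => /L1 ->.
rewrite !out // => J; rewrite finsupp_var_mset => /imfsetP[i _ ->]; exact: mdegU.
Qed.

(** The coefficients of X h_1 outside degree 1 vanish, and h_k o 0 = 0 for
    0 < k. *)
Lemma hop_term_lin X (K : {cmonom mon}) :
  K <> var_mset (meval K) -> hop_term (X *: hsym R 1%N) K = 0.
Proof.
move=> Kl; have [I IK I1] : exists2 I, I \in finsupp K & mdeg I <> 1%N.
  apply: contrapT => h; apply/Kl/var_mset_meval => I IK.
  by apply: contrapT => I1; apply: h; exists I.
rewrite /hop_term (big_fsetD1 I) //=; move/eqP/negPf: I1 => ->.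
by rewrite mulr0 hop_0 cmE_eq0 IK mul0r.
Qed.

Lemma hop_coef_lin X k (m : mon) : hop_coef k (X *: hsym R 1%N) m =
  if k == mdeg m then \prod_(i <- finsupp m) hop (m i) X else 0.
Proof.
case: eqP => [->|km].
  rewrite /hop_coef (fsbigE [:: var_mset m]) //=.
  - rewrite big_cons big_nil ifT; last first.
      by apply/mem_set; rewrite /= mdeg_var_mset meval_var_mset.
    rewrite addr0 /hop_term big_var_mset; apply: eq_bigr => i _.
    by rewrite var_msetE /= mdegU eqxx mulr1.
  - by move=> K; rewrite /= inE => /eqP ->; rewrite mdeg_var_mset meval_var_mset.
  - move=> K /= [_ Km]; rewrite inE => /eqP Kl; apply: hop_term_lin.
    by rewrite Km.
rewrite /hop_coef fsbig1 // => K [/= Kk Km]; apply: hop_term_lin => Kl.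
by apply: km; rewrite -Kk Kl mdeg_var_mset Km.
Qed.

Lemma Exp_lin X : Exp (X *: hsym R 1%N) = mult_series (fun n => hop n X).
Proof.
apply: spsP => m /=; rewrite (fsbigE [:: mdeg m]) //=.
  rewrite big_cons big_nil ifT; last exact/mem_set.
  by rewrite addr0 [LHS]hop_coef_lin eqxx.
by move=> k _; rewrite inE => /negPf km; rewrite [LHS]hop_coef_lin km.
Qed.

Lemma antipode_Exp X :
  antipode (Exp (X *: hsym R 1%N)) = Exp (- X *: hsym R 1%N).
Proof.
rewrite !Exp_lin; apply: antipode_mult_series_conv => [|n]; first exact: hop0.
by rewrite -hopD subrr hop_0.
Qed.
End Exponential.

Theorem theorem2p2p1 (R : preLambdaRingType) (C : comPzRingType)
  (E : {additive R -> C}) (E1 : E 1 = 1) (X : R) :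
  sps_map E (Exp (- X *: hsym R 1%N)) =
  omega_tilde (sps_map E (Exp (X *: hsym R 1%N))).
Proof. by rewrite omega_tildeE -antipode_Exp sps_map_antipode. Qed.
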